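(* For all $x,y\in\mathbb{B}^n$ we have $$\rho_{\mathbb{B}^n}(x,y)-2\log 2\le u_{\mathbb{B}^n}(x,y)\le 2\rho_{\mathbb{B}^n}(x,y)+2\log 2.$$
   Context: Here $n\ge 2$ and $\mathbb{B}^n=\{z\in\mathbb{R}^n:|z|<1\}$ is the Euclidean unit ball. The hyperbolic metric of $\mathbb{B}^n$ is $\rho_{\mathbb{B}^n}(x,y)=\inf_\gamma\int_\gamma \frac{2|dz|}{1-|z|^2}$, the infimum over all rectifiable curves $\gamma\subset\mathbb{B}^n$ joining $x$ and $y$; equivalently $\sinh\left(\frac{\rho_{\mathbb{B}^n}(x,y)}{2}\right)=\frac{|x-y|}{\sqrt{(1-|x|^2)(1-|y|^2)}}$. For a domain (open connected set) $D\subsetneq\mathbb{R}^n$, write $d(x)=\mathrm{dist}(x,\partial D)$ and define $u_D(x,y)=2\log\frac{|x-y|+\max\{d(x),d(y)\}}{\sqrt{d(x)d(y)}}$ for $x,y\in D$; for $D=\mathbb{B}^n$ one has $d(x)=1-|x|$. *)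

(* Defs.v *)
From HB Require Import structures.
From mathcomp Require Import all_boot all_order all_algebra.
From mathcomp Require Import all_classical all_reals all_analysis.
Set Implicit Arguments.
Unset Strict Implicit.
Unset Printing Implicit Defensive.
Import Order.TTheory GRing.Theory Num.Theory.
Import numFieldNormedType.Exports.
Local Open Scope classical_set_scope.
Local Open Scope ring_scope.

(* MathComp-Analysis norms ['rV[R]_n] by the sup norm, so the Euclidean norm is
   defined here.  Both induce the same topology: closure, interior and
   continuity below are the library's. *)
Definition enorm (R : realType) (n : nat) (x : 'rV[R]_n) : R :=
  Num.sqrt (\sum_(i < n) x 0 i ^+ 2).

Definition unit_ball (R : realType) (n : nat) : set 'rV[R]_n :=
  [set z | enorm z < 1].

Definition boundary (T : topologicalType) (D : set T) : set T :=
  closure D `\` interior D.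

Definition bdist (R : realType) (n : nat) (D : set 'rV[R]_n) (x : 'rV[R]_n) : R :=
  inf [set enorm (x - z) | z in boundary D].

Definition u_metric (R : realType) (n : nat) (D : set 'rV[R]_n)
    (x y : 'rV[R]_n) : R :=
  2 * ln ((enorm (x - y) + Num.max (bdist D x) (bdist D y))
          / Num.sqrt (bdist D x * bdist D y)).

(* Length of [g] on [a, b] (a partition [s] lists its points without [a]);
   vector-valued counterpart of [total_variation]. *)
Definition curve_length (R : realType) (n : nat) (a b : R) (g : R -> 'rV[R]_n)
    : \bar R :=
  ereal_sup [set (\sum_(0 <= k < size s)
      enorm (g (nth b (a :: s) k.+1) - g (nth b (a :: s) k)))%:E
    | s in [set s | itv_partition a b s]].

(* Arc length parametrization of a rectifiable curve: the value at [s] is [g t]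
   for any [t] in [a, b] such that [g] has length [s] on [a, t].  Such a [t]
   exists for 0 <= s <= curve_length a b g, and [g t] does not depend on it. *)
Definition arc_param (R : realType) (n : nat) (a b : R) (g : R -> 'rV[R]_n)
    (s : R) : 'rV[R]_n :=
  g (xget a [set t | a <= t <= b /\ curve_length a t g = s%:E]).

(* The integral of [f] along [g] with respect to arc length |dz|. *)
Definition path_integral (R : realType) (n : nat) (a b : R)
    (g : R -> 'rV[R]_n) (f : 'rV[R]_n -> R) : \bar R :=
  (\int[lebesgue_measure]_(s in `[0%R, fine (curve_length a b g)])
     (f (arc_param a b g s))%:E)%E.

Definition rectifiable_curve (R : realType) (n : nat) (D : set 'rV[R]_n)
    (x y : 'rV[R]_n) (a b : R) (g : R -> 'rV[R]_n) : Prop :=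
  [/\ a <= b, {within `[a, b], continuous g},
      (forall t, a <= t <= b -> D (g t)),
      g a = x /\ g b = y & (curve_length a b g < +oo)%E].

Definition hyp_dist (R : realType) (n : nat) (x y : 'rV[R]_n) : R :=
  fine (ereal_inf [set l | exists a b (g : R -> 'rV[R]_n),
    rectifiable_curve (@unit_ball R n) x y a b g /\
    l = path_integral a b g (fun z => 2 / (1 - enorm z ^+ 2))]).

(* Main.v *)
(* Upper bound on the distance: with m the larger of the two boundary distances
   and h = |x - y| + m, run radially inward from x to depth h, across along a
   chord, and radially outward to y (through the centre if h >= 1).  Radial
   pieces cost differences of ln ((1 + t) / (1 - t)), and since |x/|x| - y/|y||
   <= h the chord costs at most 2 (1 - h) / (2 - h) <= 2 ln (2 - h), exactly
   the amount the radial pieces save.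
   Lower bound: a curve parametrized by arc length is at distance at most s from
   its endpoint x at time s, so the density there is at least 1 / (d(x) + s);
   hence rho >= ln (1 + |x - y| / d(x)), and symmetrically at y. *)
Require Import Defs.
From HB Require Import structures.
From mathcomp Require Import all_boot all_order all_algebra.
From mathcomp Require Import all_classical all_reals all_analysis.
From mathcomp Require Import measurable_realfun ring lra.
Set Implicit Arguments.
Unset Strict Implicit.
Unset Printing Implicit Defensive.
Import Order.TTheory GRing.Theory Num.Theory.
Import numFieldNormedType.Exports.
Local Open Scope classical_set_scope.
Local Open Scope ring_scope.

(** * Euclidean norm *)

Definition dotv (R : realType) (n : nat) (x y : 'rV[R]_n) : R :=
  \sum_(i < n) x 0 i * y 0 i.

Lemma dotv_ge0 (R : realType) (n : nat) (x : 'rV[R]_n) : 0 <= dotv x x.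
Proof. by apply: sumr_ge0 => i _; rewrite -expr2 sqr_ge0. Qed.

Lemma dotvC (R : realType) (n : nat) (x y : 'rV[R]_n) : dotv x y = dotv y x.
Proof. by apply: eq_bigr => i _; rewrite mulrC. Qed.

Lemma dotvDr (R : realType) (n : nat) (x y z : 'rV[R]_n) :
  dotv x (y + z) = dotv x y + dotv x z.
Proof. by rewrite -big_split; apply: eq_bigr => i _; rewrite mxE mulrDr. Qed.

Lemma dotvZr (R : realType) (n : nat) (k : R) (x y : 'rV[R]_n) :
  dotv x (k *: y) = k * dotv x y.
Proof. by rewrite mulr_sumr; apply: eq_bigr => i _; rewrite mxE; ring. Qed.

Lemma enormE (R : realType) (n : nat) (x : 'rV[R]_n) : enorm x = Num.sqrt (dotv x x).
Proof. by congr Num.sqrt; apply: eq_bigr => i _; rewrite expr2. Qed.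

Lemma enorm_ge0 (R : realType) (n : nat) (x : 'rV[R]_n) : 0 <= enorm x.
Proof. exact: sqrtr_ge0. Qed.

Lemma enorm_sqr (R : realType) (n : nat) (x : 'rV[R]_n) : enorm x ^+ 2 = dotv x x.
Proof. by rewrite enormE sqr_sqrtr ?dotv_ge0. Qed.

Lemma enormZ (R : realType) (n : nat) (k : R) (x : 'rV[R]_n) :
  enorm (k *: x) = `|k| * enorm x.
Proof.
rewrite !enormE dotvZr dotvC dotvZr mulrA -expr2 sqrtrM ?sqr_ge0//.
by rewrite sqrtr_sqr.
Qed.

Lemma enorm0 (R : realType) (n : nat) : enorm (0 : 'rV[R]_n) = 0.
Proof. by rewrite -(scale0r (0 : 'rV[R]_n)) enormZ normr0 mul0r. Qed.

Lemma enormN (R : realType) (n : nat) (x : 'rV[R]_n) : enorm (- x) = enorm x.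
Proof. by rewrite -scaleN1r enormZ normrN1 mul1r. Qed.

Lemma enormB (R : realType) (n : nat) (x y : 'rV[R]_n) : enorm (x - y) = enorm (y - x).
Proof. by rewrite -enormN opprB. Qed.

Lemma enorm_eq0 (R : realType) (n : nat) (x : 'rV[R]_n) : enorm x = 0 -> x = 0.
Proof.
move=> x0; have : dotv x x = 0 by rewrite -enorm_sqr x0 expr0n.
move=> /eqP; rewrite psumr_eq0 => [/allP xi|i _]; last by rewrite -expr2 sqr_ge0.
apply/rowP => i; rewrite mxE.
have := xi i (mem_index_enum i); rewrite -expr2 sqrf_eq0; exact: eqP.
Qed.

(** Cauchy-Schwarz: the square of the vector |y| x - |x| y is nonnegative and expands to 2 |x| |y|
    (|x| |y| - x.y); the positive factor |x| |y| is then cancelled. *)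
Lemma dotv_le_enorm (R : realType) (n : nat) (x y : 'rV[R]_n) :
  dotv x y <= enorm x * enorm y.
Proof.
have [x0|x0] := eqVneq (enorm x) 0.
  by rewrite x0 (enorm_eq0 x0) mul0r /dotv big1// => i _; rewrite mxE mul0r.
have [y0|y0] := eqVneq (enorm y) 0.
  by rewrite y0 (enorm_eq0 y0) mulr0 /dotv big1// => i _; rewrite mxE mulr0.
have xy : 0 < enorm x * enorm y by rewrite mulr_gt0// lt0r ?x0 ?y0 enorm_ge0.
have := dotv_ge0 (enorm y *: x + (- enorm x) *: y).
rewrite dotvDr !dotvZr ![dotv (_ + _) _]dotvC !dotvDr !dotvZr (dotvC y x).
rewrite -!enorm_sqr => h.
have {h} : 0 <= (enorm x * enorm y) * (enorm x * enorm y - dotv x y) by nra.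
by rewrite pmulr_rge0// subr_ge0.
Qed.

Lemma ler_enormD (R : realType) (n : nat) (x y : 'rV[R]_n) :
  enorm (x + y) <= enorm x + enorm y.
Proof.
rewrite -(@ler_pXn2r _ 2)// ?nnegrE ?addr_ge0 ?enorm_ge0//.
rewrite enorm_sqr dotvDr ![dotv (_ + _) _]dotvC !dotvDr (dotvC y x) -!enorm_sqr.
have := dotv_le_enorm x y; nra.
Qed.

Lemma ler_enorm_trans (R : realType) (n : nat) (y x z : 'rV[R]_n) :
  enorm (x - z) <= enorm (x - y) + enorm (y - z).
Proof. by rewrite -(subrKA y x (- z)) ler_enormD. Qed.

Lemma ler_dist_enorm (R : realType) (n : nat) (x y : 'rV[R]_n) :
  `|enorm x - enorm y| <= enorm (x - y).
Proof.
have h (u v : 'rV[R]_n) : enorm u <= enorm v + enorm (u - v).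
  by rewrite -[in leLHS](subrKC v u) ler_enormD.
rewrite ler_norml; have := h x y; have := h y x; rewrite (enormB y x); lra.
Qed.

(** Polar form that includes the origin, where a coordinate vector serves as direction; later
    constructions then need no case x = 0. *)
Lemma unit_vector_exists (R : realType) (n : nat) (hn : (0 < n)%N) (x : 'rV[R]_n) :
  exists v : 'rV[R]_n, enorm v = 1 /\ x = enorm x *: v.
Proof.
have [x0|x0] := eqVneq (enorm x) 0.
  exists (delta_mx 0 (Ordinal hn)); split; last by rewrite x0 scale0r; exact: enorm_eq0.
  rewrite /enorm (bigD1 (Ordinal hn))//= big1 => [|i ni]; rewrite !mxE ?eqxx ?(negbTE ni).
    by rewrite expr1n addr0 sqrtr1.
  by rewrite expr0n.
exists ((enorm x)^-1 *: x); split; last by rewrite scalerA divff// scale1r.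
by rewrite enormZ ger0_norm ?invr_ge0 ?enorm_ge0// mulVf.
Qed.

(* Equality would hold with [(a - b) ^+ 2] added to the left-hand side. *)
Lemma enorm_directions (R : realType) (n : nat) (a b : R) (v w : 'rV[R]_n) :
  enorm v = 1 -> enorm w = 1 ->
  a * b * enorm (v - w) ^+ 2 <= enorm (a *: v - b *: w) ^+ 2.
Proof.
move=> v1 w1; rewrite -scaleNr -[v - w]/(v + - w) -(scaleN1r w) !enorm_sqr.
rewrite !dotvDr !dotvZr ![dotv (_ + _) _]dotvC !dotvDr !dotvZr (dotvC w v).
rewrite -!enorm_sqr v1 w1; have := sqr_ge0 (a - b); nra.
Qed.

Lemma enorm_continuous (R : realType) (n : nat) : continuous (@enorm R n).
Proof.
move=> x; rewrite /continuous_at /enorm.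
apply: (@continuous_comp _ _ _ (fun z : 'rV[R]_n => \sum_(i < n) z 0 i ^+ 2) Num.sqrt).
  apply: (@cvg_big R^o 'I_n +%R 0 xpredT add_continuous _ (nbhs x) _
    (fun i (z : 'rV[R]_n) => z 0 i ^+ 2) _ (nbhs_filter x)) => i _.
  apply: (@cvg_comp _ _ _ (fun z : 'rV[R]_n => z 0 i) (@GRing.exp R ^~ 2) (nbhs x)
    (nbhs (x 0 i))).
    exact: coord_continuous.
  exact: exprn_continuous.
exact: sqrt_continuous.
Qed.

(** Here [|x|] is the sup norm, attained at one coordinate. This turns Euclidean Lipschitz bounds
    into continuity for the topology on row vectors. *)
Lemma norm_le_enorm (R : realType) (n : nat) (x : 'rV[R]_n) : `|x| <= enorm x.
Proof.
rewrite -[leLHS]/(mx_norm x); have [->|/(@mx_norm_neq0 _ _ _ x)[ij E]] := eqVneq (mx_norm x) 0.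
  exact: sqrtr_ge0.
rewrite E ord1 -sqrtr_sqr; apply: ler_wsqrtr; rewrite (bigD1 ij.2)//= lerDl.
by apply: sumr_ge0 => j _; rewrite sqr_ge0.
Qed.

(** * Length of curves *)

(** The inscribed polygon sum of [curve_length], in a recursive form suited to induction on the
    partition. *)
Fixpoint polylen (R : realType) (n : nat) (g : R -> 'rV[R]_n) (a : R) (s : seq R) : R :=
  if s is x :: t then enorm (g x - g a) + polylen g x t else 0.

Lemma polylenE (R : realType) (n : nat) (g : R -> 'rV[R]_n) (a b : R) (s : seq R) :
  \sum_(0 <= k < size s)
      enorm (g (nth b (a :: s) k.+1) - g (nth b (a :: s) k)) = polylen g a s.
Proof.
elim: s a => [|x t IH] a; first by rewrite big_nil.
by rewrite big_nat_recl//= -IH.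
Qed.

Lemma polylen_cat (R : realType) (n : nat) (g : R -> 'rV[R]_n) (a c : R) (s t : seq R) :
  last a s = c -> polylen g a (s ++ t) = polylen g a s + polylen g c t.
Proof.
elim: s a => [|x s IH] a /=; first by move=> ->; rewrite add0r.
by move=> /IH ->; rewrite addrA.
Qed.

(** By the triangle inequality, inserting c as a vertex does not shorten the polygon, which can then
    be cut at c. *)
Lemma polylen_split (R : realType) (n : nat) (g : R -> 'rV[R]_n) (a b c : R) (s : seq R) :
  a <= c -> c <= b -> itv_partition a b s ->
  exists s1 s2, [/\ itv_partition a c s1, itv_partition c b s2 &
    polylen g a s <= polylen g a s1 + polylen g c s2].
Proof.
elim: s a => [|x t IH] a ac cb abs.
  have ab := itv_partition_nil abs; subst b.
  have ac' : a = c by apply/eqP; rewrite eq_le ac cb.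
  by subst c; exists [::], [::]; split => //=; rewrite addr0.
have [xc|cx] := leP x c.
  have [s1 [s2 [xs1 cs2 le12]]] := IH x xc cb (itv_partition_cons abs).
  exists (x :: s1), s2; split => //=; last by rewrite -addrA lerD2l.
  case: abs xs1 => /= /andP[ax _] _ [ps1 ls1].
  by split => //=; rewrite ax.
(* Partitions are strictly increasing and omit their left end, so c = a calls for the empty
   partition on the left. *)
move: ac; rewrite le_eqVlt => /predU1P[<-|ac].
  by exists [::], (x :: t); split => //=; rewrite add0r.
exists [:: c], (x :: t); split => /=.
- exact: itv_partition1.
- by case: abs => /= /andP[_ pt] lt; split => //=; rewrite cx.
- by rewrite addr0 addrA lerD2r [leRHS]addrC ler_enorm_trans.
Qed.

Lemma polylen_le_length (R : realType) (n : nat) (g : R -> 'rV[R]_n) (a b : R) (s : seq R) :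
  itv_partition a b s -> ((polylen g a s)%:E <= curve_length a b g)%E.
Proof. by move=> abs; apply: ereal_sup_ubound; exists s => //=; rewrite polylenE. Qed.

Lemma length_le (R : realType) (n : nat) (g : R -> 'rV[R]_n) (a b : R) (M : \bar R) :
  (forall s, itv_partition a b s -> ((polylen g a s)%:E <= M)%E) ->
  (curve_length a b g <= M)%E.
Proof. by move=> h; apply: ge_ereal_sup => _ [s abs <-]; rewrite polylenE; exact: h. Qed.

Lemma polylen_gt (R : realType) (n : nat) (g : R -> 'rV[R]_n) (a b : R) (M : \bar R) :
  (M < curve_length a b g)%E ->
  exists2 s, itv_partition a b s & (M < (polylen g a s)%:E)%E.
Proof. by move=> /ereal_sup_gt[_ [s abs <-]]; rewrite polylenE; exists s. Qed.

Lemma chord_le_length (R : realType) (n : nat) (g : R -> 'rV[R]_n) (a b : R) :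
  a <= b -> ((enorm (g b - g a))%:E <= curve_length a b g)%E.
Proof.
rewrite le_eqVlt => /predU1P[->|ab].
  by rewrite subrr enorm0; apply: (@polylen_le_length _ _ g b b [::]); split => /=.
by have := polylen_le_length g (itv_partition1 ab); rewrite /= addr0.
Qed.

Lemma length_ge0 (R : realType) (n : nat) (g : R -> 'rV[R]_n) (a b : R) :
  a <= b -> (0 <= curve_length a b g)%E.
Proof.
by move=> /(chord_le_length g); apply: le_trans; rewrite lee_fin enorm_ge0.
Qed.

Lemma lengthxx (R : realType) (n : nat) (g : R -> 'rV[R]_n) (a : R) :
  curve_length a a g = 0%E.
Proof.
apply/eqP; rewrite eq_le length_ge0// andbT; apply: length_le => s /itv_partitionxx ->.
exact: lexx.
Qed.

(** One inequality comes from cutting a partition of [a, b] at c, the other from concatenating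
    partitions of the two halves. *)
Lemma lengthD (R : realType) (n : nat) (g : R -> 'rV[R]_n) (a b c : R) :
  a <= c -> c <= b ->
  curve_length a b g = (curve_length a c g + curve_length c b g)%E.
Proof.
move=> ac cb; apply/eqP; rewrite eq_le; apply/andP; split.
  apply: length_le => s /(polylen_split g ac cb)[s1 [s2 [h1 h2 h]]].
  apply: (@le_trans _ _ (polylen g a s1 + polylen g c s2)%:E); first by rewrite lee_fin.
  by rewrite EFinD leeD// polylen_le_length.
have step s1 : itv_partition a c s1 ->
    ((polylen g a s1)%:E + curve_length c b g <= curve_length a b g)%E.
  move=> h1; rewrite addeC -leeBrDr//; apply: length_le => s2 h2.
  rewrite leeBrDr// -EFinD addrC; have [_ /eqP l1] := h1.
  rewrite -(polylen_cat g s2 l1); apply: polylen_le_length.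
  exact: itv_partition_cat h1 h2.
(* A finite length can be moved across the inequality before taking the supremum over [s1]. If it is
   infinite, a single partition of [a, c] already forces the total to be infinite. *)
have [fin|nfin] := boolP (curve_length c b g \is a fin_num).
  rewrite -leeBrDr//; apply: length_le => s1 h1; rewrite leeBrDr//; exact: step.
have ly : curve_length c b g = +oo%E.
  by move: nfin; rewrite ge0_fin_numE ?length_ge0// ltey negbK => /eqP.
have : exists s1, itv_partition a c s1.
  move: ac; rewrite le_eqVlt => /predU1P[->|ac]; first by exists [::]; split => /=.
  by exists [:: c]; exact: itv_partition1.
by move=> [s1 /step]; rewrite ly addey// => h; rewrite (le_trans _ h)// leey.
Qed.

Lemma eq_length (R : realType) (n : nat) (g h : R -> 'rV[R]_n) (a b : R) :
  (forall t, a <= t <= b -> g t = h t) -> curve_length a b g = curve_length a b h.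
Proof.
move=> gh; have eqp s : itv_partition a b s -> polylen g a s = polylen h a s.
  elim: s a gh => //= x t IH a gh abs.
  have xb := itv_partition_le (itv_partition_cons abs).
  have ab := itv_partition_le abs.
  have ax : a <= x by case: abs => /= /andP[/ltW].
  rewrite !gh ?lexx ?ax//; congr +%R; apply: IH (itv_partition_cons abs).
  by move=> z /andP[xz zb]; rewrite gh// zb (le_trans ax).
apply/eqP; rewrite eq_le; apply/andP; split; apply: length_le => s abs.
  by rewrite eqp//; exact: polylen_le_length.
by rewrite -eqp//; exact: polylen_le_length.
Qed.

Lemma length_line (R : realType) (n : nat) (p v : 'rV[R]_n) (c a b : R) :
  a <= b -> enorm v = 1 ->
  curve_length a b (fun s => p + (s - c) *: v) = (b - a)%:E.
Proof.
move=> ab v1; have seg s t : s <= t ->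
    enorm ((p + (t - c) *: v) - (p + (s - c) *: v)) = t - s.
  move=> st; rewrite opprD addrACA subrr add0r -scalerBl enormZ v1 mulr1.
  by rewrite opprB addrA subrK ger0_norm// subr_ge0.
apply/eqP; rewrite eq_le; apply/andP; split; last first.
  by rewrite -(seg a b)//; exact: (chord_le_length (fun s => p + (s - c) *: v)).
apply: length_le => s; rewrite lee_fin.
elim: s a {ab} => [|x t IH] a abs /=.
  by rewrite (itv_partition_nil abs) subrr.
have ax : a <= x by case: abs => /= /andP[/ltW].
by rewrite seg//; have := IH _ (itv_partition_cons abs); lra.
Qed.

(** * Arc length parametrization *)

Lemma length_split (R : realType) (n : nat) (g : R -> 'rV[R]_n) (a b c l : R) :
  a <= c -> c <= b -> curve_length a b g = l%:E ->
  exists l1 l2, [/\ curve_length a c g = l1%:E, curve_length c b g = l2%:E &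
    l = l1 + l2].
Proof.
move=> ac cb; rewrite (lengthD g ac cb).
have := length_ge0 g ac; have := length_ge0 g cb.
case: (curve_length c b g) => [l2| |] //; case: (curve_length a c g) => [l1| |] // _ _.
by rewrite -EFinD => -[<-]; exists l1, l2.
Qed.

(** Epsilon-delta form of continuity on [a, b], measured by the Euclidean norm. *)
Lemma within_continuous_enorm (R : realType) (n : nat) (g : R -> 'rV[R]_n) (a b t e : R) :
  {within `[a, b], continuous g} -> a <= t <= b -> 0 < e ->
  exists2 d, 0 < d &
    forall u, a <= u <= b -> `|u - t| < d -> enorm (g u - g t) < e.
Proof.
move=> cg tab e0; have tA : `[a, b]%classic t by rewrite /= in_itv/=.
have gt := (subspace_continuousP _ _).1 cg _ tA.
have : enorm (g u - g t) @[u --> within `[a, b]%classic (nbhs t)] --> (0 : R).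
  rewrite -(enorm0 R n) -(subrr (g t)).
  apply: (@cvg_comp _ _ _ (fun u => g u - g t) (@enorm R n) _ (nbhs (g t - g t))).
    by apply: cvgB => //; exact: cvg_cst.
  exact: enorm_continuous.
move=> /cvgrPdist_lt/(_ e e0); rewrite near_withinE => -[d /= d0 h].
exists d => // u uab ut; have := h u; rewrite /= distrC sub0r normrN in_itv/=.
by move=> /(_ ut uab); rewrite ger0_norm ?enorm_ge0.
Qed.

(** An intermediate value property of arc length. The time sought is the supremum T of the times up
    to which the length is at most s; continuity of g excludes a jump of the length on either side
    of T. *)
Lemma length_attained (R : realType) (n : nat) (g : R -> 'rV[R]_n) (a b l s : R) :
  a <= b -> {within `[a, b], continuous g} -> curve_length a b g = l%:E ->
  0 <= s <= l -> exists2 t, a <= t <= b & curve_length a t g = s%:E.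
Proof.
move=> ab cg gl /andP[s0 sl].
pose A := [set t | a <= t <= b /\ (curve_length a t g <= s%:E)%E].
have Aa : A a by rewrite /A /= lexx ab lengthxx lee_fin.
have ubA : ubound A b by move=> t [/andP[]].
have supA : has_sup A by split; [exists a | exists b].
pose T := sup A.
have aT : a <= T by apply: ub_le_sup => //; exists b.
have Tb : T <= b by apply: ge_sup => //; exists a.
exists T; first by rewrite aT.
have [l1 [l2 [aTl1 Tbl2 ll]]] := length_split aT Tb gl.
rewrite aTl1; congr EFin; apply/eqP; rewrite eq_le; apply/andP; split.
  rewrite leNgt; apply/negP => sl1.
  (* Suppose the length on [a, T] exceeds s: some polygon does too. Moving its last vertex from T to
     a nearby time t of [A] costs less than the excess, so the length on [a, t] would exceed s. *)
  have [u aTu] : exists2 u, itv_partition a T u & s < polylen g a u.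
    have [|u aTu] := @polylen_gt _ _ g a T s%:E; first by rewrite aTl1 lte_fin.
    by rewrite lte_fin => su; exists u.
  case/lastP: u aTu => [_ /=|u' z aTu]; first by rewrite ltNge s0.
  have zT : z = T by case: aTu => _ /eqP; rewrite last_rcons.
  subst z; rewrite -cats1 (polylen_cat g _ (erefl (last a u')))/= addr0.
  set p := last a u' => su.
  have [pu' pT] : path <%R a u' /\ p < T.
    by case: aTu; rewrite rcons_path => /andP[].
  have [||d d0 cd] := within_continuous_enorm (t := T)
    (e := polylen g a u' + enorm (g T - g p) - s) cg _ _.
  - by rewrite aT.
  - by rewrite subr_gt0.
  (* The bound T - p keeps t to the right of the preceding vertex p, so that the modified list is
     still a partition. *)
  have : T - Num.min d (T - p) < T by rewrite ltrBlDr ltrDl lt_min d0 subr_gt0.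
  move=> /(sup_gt (ex_intro _ a Aa))[t At].
  have tT : t <= T by apply: ub_le_sup => //; exists b.
  have [tab ts] := At; have [at_ tb] := andP tab.
  rewrite ltrBlDr -ltrBlDl lt_min => /andP[td tp].
  have pt : p < t by lra.
  have /= := cd t tab; rewrite distrC ger0_norm ?subr_ge0// => /(_ td) gtT.
  have atu : itv_partition a t (rcons u' t).
    by split; [rewrite rcons_path pu' | rewrite last_rcons].
  have := le_trans (polylen_le_length g atu) ts.
  rewrite lee_fin -cats1 (polylen_cat g _ (erefl (last a u')))/= addr0 -/p.
  by have := ler_enorm_trans (g t) (g T) (g p); rewrite (enormB (g T) (g t)); lra.
rewrite leNgt; apply/negP => l1s.
have {}Tb : T < b.
  rewrite lt_neqAle Tb andbT; apply/eqP => Tb'.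
  by move: aTl1; rewrite Tb' gl => -[]; lra.
(* Suppose the length l1 on [a, T] is below s. Take a polygon on [T, b] within (s - l1) / 2 of the
   length, and move its start to q > T with |g q - g T| < (s - l1) / 2. Then less than s - l1 of
   length lies on [T, q], so q belongs to [A], beyond its supremum. *)
have [u Tbu] : exists2 u, itv_partition T b u & l2 - (s - l1) / 2 < polylen g T u.
  have [|u aTu] := @polylen_gt _ _ g T b (l2 - (s - l1) / 2)%:E.
    by rewrite Tbl2 lte_fin; lra.
  by rewrite lte_fin => su; exists u.
case: u Tbu => [/itv_partition_nil|p u' Tbu /= lu]; first by lra.
have Tp : T < p by case: Tbu => /= /andP[].
have pu' := itv_partition_cons Tbu.
have [||d d0 cd] := within_continuous_enorm (t := T) (e := (s - l1) / 2) cg _ _.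
- by rewrite aT ltW.
- by lra.
have pb := itv_partition_le pu'.
have [q [Tq qp qd]] : exists q, [/\ T < q, q < p & q - T < d].
  exists (T + Num.min d (p - T) / 2); rewrite !ltrDl.
  have [dp|dp] := leP d (p - T); split; lra.
have qb : q <= b by lra.
have [l3 [l4 [Tql3 qbl4 ll']]] := length_split (ltW Tq) qb Tbl2.
have qbu : itv_partition q b (p :: u').
  by case: pu' => /= pu' ?; split => //=; rewrite qp.
have := polylen_le_length g qbu; rewrite qbl4 lee_fin /= => h4.
have := cd q; rewrite qb (le_trans aT (ltW Tq))/= ger0_norm ?subr_ge0 ?ltW//.
move=> /(_ isT qd) gqT.
have := ler_enorm_trans (g q) (g p) (g T) => h5.
have aq : a <= q by lra.
have : A q.
  split; first by rewrite aq.
  by rewrite (lengthD g aT (ltW Tq)) aTl1 Tql3 -EFinD lee_fin; lra.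
by move=> /(ub_le_sup (ex_intro _ b ubA)); rewrite -/T; lra.
Qed.

(** Cutting at a time where the length is s leaves arcs of length s and l - s, and a chord is no
    longer than its arc. [length_attained] excludes the default value of [xget]. *)
Lemma arc_param_lipschitz (R : realType) (n : nat) (g : R -> 'rV[R]_n) (a b l s : R) :
  a <= b -> {within `[a, b], continuous g} -> curve_length a b g = l%:E ->
  0 <= s <= l ->
  [/\ exists2 t, a <= t <= b & arc_param a b g s = g t,
      enorm (g a - arc_param a b g s) <= s &
      enorm (g b - arc_param a b g s) <= l - s].
Proof.
move=> ab cg gl sl; rewrite /arc_param.
case: xgetP => [t _ [tab ts]|none]; last first.
  by have [t tab ts] := length_attained ab cg gl sl; have /(_ t) := none; case.
have [at_ tb] := andP tab.
split; first by exists t.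
  by have := chord_le_length g at_; rewrite ts lee_fin enormB.
have [l1 [l2 []]] := length_split at_ tb gl; rewrite ts => -[->] tl2 ->.
by have := chord_le_length g tb; rewrite tl2 lee_fin; lra.
Qed.

(** * Lower bound for path integrals *)

(* Unlike [ge0_le_integral], no measurability is assumed. *)
Lemma integral_le (R : realType) (D : set R) (f h : R -> R) :
  (forall s, D s -> 0 <= f s <= h s) ->
  (\int[lebesgue_measure]_(s in D) (f s)%:E <=
   \int[lebesgue_measure]_(s in D) (h s)%:E)%E.
Proof.
move=> fh; rewrite !ge0_integralE; last 2 first.
- by move=> s /fh /andP[f0 fhs]; rewrite lee_fin (le_trans f0).
- by move=> s /fh /andP[f0 _]; rewrite lee_fin.
(* Both integrals are suprema over simple functions lying below the integrand; those below f also
   lie below h. *)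
apply: ereal_sup_le => _ [k kf <-]; exists k => // s.
apply: (le_trans (kf s)); rewrite /patch; case: ifPn => // /set_mem /fh /andP[_].
by rewrite lee_fin.
Qed.

(** The case a = b is included because radial and chordal pieces may degenerate to a point. *)
Lemma integral_FTC (R : realType) (f F : R -> R) (a b : R) :
  a <= b ->
  (forall s, a <= s <= b -> is_derive s 1 F (f s)) ->
  (forall s, a <= s <= b -> {for s, continuous f}) ->
  measurable_fun `[a, b]%classic f /\
  (\int[lebesgue_measure]_(s in `[a, b]) (f s)%:E = (F b - F a)%:E)%E.
Proof.
move=> ab dF cf.
have wcf : {within `[a, b], continuous f}.
  by apply/continuous_in_subspaceT => s; rewrite inE/= in_itv/=; exact: cf.
split; first exact: subspace_continuous_measurable_fun.
have cF s : a <= s <= b -> {for s, continuous F}.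
  move=> /dF dFs; apply/differentiable_continuous; rewrite -derivable1_diffP.
  exact: ex_derive.
move: ab; rewrite le_eqVlt => /predU1P[ab|ab].
  by subst b; rewrite set_itv1 integral_set1 subrr.
rewrite (continuous_FTC2 ab wcf (F := F))//.
- split.
  + move=> s; rewrite in_itv/= => /andP[as_ sb].
    by apply: (@ex_derive _ _ _ _ _ _ (f s)); apply: dF; rewrite !ltW.
  + by apply: cvg_at_right_filter; apply: cF; rewrite lexx ltW.
  + by apply: cvg_at_left_filter; apply: cF; rewrite lexx ltW.
- move=> s; rewrite in_itv/= => /andP[as_ sb].
  by rewrite derive1E; apply: derive_val; apply: dF; rewrite !ltW.
Qed.

Lemma is_derive_ln_affine (R : realType) (c k s : R) : 0 < c + k * s ->
  is_derive s 1 (fun t : R => ln (c + k * t)) (k / (c + k * s)).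
Proof.
move=> pos; have d1 : is_derive s 1 (fun t : R => c + k * t) k.
  have := is_deriveD (is_derive_cst c s 1) (is_deriveZ k (is_derive_id s 1)).
  by rewrite add0r [k *: 1]mulr1.
have d2 := is_derive1_ln pos.
have := @is_derive1_comp _ (@ln R) (fun t => c + k * t) s _ _ d2 d1.
by rewrite mulrC.
Qed.

Lemma continuous_inv_affine (R : realType) (c k s : R) : 0 < c + k * s ->
  {for s, continuous (fun t : R => k / (c + k * t))}.
Proof.
move=> pos; apply: cvgM; first exact: cvg_cst.
apply: cvgV; first by rewrite gt_eqF.
by apply: cvgD; [exact: cvg_cst | apply: cvgM; [exact: cvg_cst|exact: cvg_id]].
Qed.

Definition hyp_density (R : realType) (n : nat) (z : 'rV[R]_n) : R :=
  2 / (1 - enorm z ^+ 2).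

(** The density is 2 / ((1 - |z|) (1 + |z|)), and 1 + |z| <= 2. *)
Lemma hyp_density_ge (R : realType) (n : nat) (z : 'rV[R]_n) (w : R) :
  unit_ball z -> 1 - enorm z <= w -> w^-1 <= hyp_density z.
Proof.
rewrite /unit_ball /= => z1 zw; have z0 := enorm_ge0 z.
have p1 : 0 < 1 - enorm z ^+ 2 by nra.
have w0 : 0 < w by lra.
rewrite /hyp_density ler_pdivlMr// mulrC ler_pdivrMr//; nra.
Qed.

Lemma hyp_density_le (R : realType) (n : nat) (z : 'rV[R]_n) (k : R) :
  enorm z <= k -> k < 1 -> hyp_density z <= 2 / (1 - k ^+ 2).
Proof.
move=> zk k1; have z0 := enorm_ge0 z.
by rewrite ler_pM2l// lef_pV2 ?posrE; nra.
Qed.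

Lemma hyp_density_ge0 (R : realType) (n : nat) (z : 'rV[R]_n) :
  unit_ball z -> 0 <= hyp_density z.
Proof.
move=> z1; apply: le_trans (hyp_density_ge z1 (lexx _)).
by rewrite invr_ge0 subr_ge0 ltW.
Qed.

Lemma path_integral_ge (R : realType) (n : nat) (x y : 'rV[R]_n) (a b : R)
    (g : R -> 'rV[R]_n) :
  rectifiable_curve (@unit_ball R n) x y a b g ->
  ((ln ((1 - enorm x + enorm (x - y)) / (1 - enorm x)))%:E <=
     path_integral a b g (@hyp_density R n))%E /\
  ((ln ((1 - enorm y + enorm (x - y)) / (1 - enorm y)))%:E <=
     path_integral a b g (@hyp_density R n))%E.
Proof.
move=> [ab cg gball [<- <-] fin].
have gaB : enorm (g a) < 1 by apply: gball; rewrite lexx.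
have gbB : enorm (g b) < 1 by apply: gball; rewrite lexx ab.
have len_fin : curve_length a b g \is a fin_num by rewrite ge0_fin_numE// length_ge0.
have lE := esym (fineK len_fin); set l := fine _ in lE.
have l_ge : enorm (g a - g b) <= l.
  by have := chord_le_length g ab; rewrite lE lee_fin enormB.
have r0 := enorm_ge0 (g a - g b).
have l0 : 0 <= l by lra.
have P s : 0 <= s <= l -> [/\ unit_ball (arc_param a b g s),
    enorm (g a - arc_param a b g s) <= s & enorm (g b - arc_param a b g s) <= l - s].
  by move=> /(arc_param_lipschitz ab cg lE)[[t tab ->] h1 h2]; split => //; exact: gball.
(* Treats both endpoints at once. For x, k = 1 and c = d, so c + k s = d + s; for y, k = -1 and c =
   d + l, so c + k s = d + (l - s). In both cases 1 / (c + k s) integrates to ln (d + l) - ln d. *)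
have key c k d : (k == 1) || (k == -1) -> 0 < d -> d + enorm (g a - g b) <= d + l ->
    (forall s, 0 <= s <= l -> 0 < c + k * s /\ 1 - enorm (arc_param a b g s) <= c + k * s) ->
    k * (ln (c + k * l) - ln (c + k * 0)) = ln (d + l) - ln d ->
    ((ln ((d + enorm (g a - g b)) / d))%:E <= path_integral a b g (@hyp_density R n))%E.
  move=> k1 d0 dl hc E.
  have kk : k * k = 1 by case/orP: k1 => /eqP ->; ring.
  (* Since k * k = 1 this integrand is 1 / (c + k s), written as the derivative of k ln (c + k
     s). *)
  have [||_ I] := @integral_FTC R (fun s => k *: (k / (c + k * s)))
     (fun s => k *: ln (c + k * s)) 0 l l0.
  - by move=> s /hc[h _]; apply: is_deriveZ; exact: is_derive_ln_affine.
  - move=> s /hc[h _]; apply: cvgZl_tmp; exact: continuous_inv_affine.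
  rewrite /path_integral -/l.
  apply: (@le_trans _ _ (ln (d + l) - ln d)%:E).
    by rewrite lee_fin ln_div ?posrE ?lerD2r ?ler_ln ?posrE//; lra.
  rewrite -E mulrBr -I; apply: integral_le => s; rewrite /= in_itv/= => sl.
  have [cs zs] := hc s sl; have [zB _ _] := P s sl.
  have -> : k *: (k / (c + k * s)) = (c + k * s)^-1.
    by rewrite -[LHS]/(k * (k / _)) mulrA kk mul1r.
  by rewrite invr_ge0 (ltW cs)/=; exact: hyp_density_ge.
split.
- apply: (key (1 - enorm (g a)) 1) => //; first by rewrite eqxx.
  + by lra.
  + by lra.
  + move=> s sl; have [zB h1 _] := P s sl; have /andP[s0 _] := sl.
    have := ler_dist_enorm (g a) (arc_param a b g s).
    by rewrite ler_norml; split; lra.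
  + by rewrite !mul1r addr0.
- apply: (key (1 - enorm (g b) + l) (-1)) => //; first by rewrite eqxx orbT.
  + by lra.
  + by lra.
  + move=> s sl; have [zB _ h1] := P s sl; have /andP[_ s0] := sl.
    have := ler_dist_enorm (g b) (arc_param a b g s).
    by rewrite ler_norml; split; lra.
  + by rewrite !mulN1r oppr0 addr0 addrK; ring.
Qed.

(** * Curves of bounded hyperbolic length *)

(* A unit-speed curve can be started at any time [a], so that concatenation needs
   no translation of the Lebesgue integral; [phi] spares the measurability of the
   density along [g]. *)
Definition reachable_at_cost (R : realType) (n : nat) (x y : 'rV[R]_n) (c : R) : Prop :=
  forall a, exists b (g : R -> 'rV[R]_n) (phi : R -> R),
  [/\ [/\ a <= b, g a = x, g b = y & forall s, a <= s <= b -> unit_ball (g s)],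
      forall s, a <= s <= b -> curve_length a s g = (s - a)%:E,
      measurable_fun `[a, b]%classic phi,
      forall s, a <= s <= b -> hyp_density (g s) <= phi s &
      (\int[lebesgue_measure]_(s in `[a, b]) (phi s)%:E <= c%:E)%E].

(** The second curve is started at the time b at which the first one ends; lengths and costs then
    add. *)
Lemma reachable_trans (R : realType) (n : nat) (x y z : 'rV[R]_n) (c d : R) :
  reachable_at_cost x y c -> reachable_at_cost y z d -> reachable_at_cost x z (c + d).
Proof.
move=> xy yz a.
have [b [g [phi [[ab ga gb gB] gl mphi gphi iphi]]]] := xy a.
have [e [h [psi [[be hb he hB] hl mpsi hpsi ipsi]]]] := yz b.
pose gh s := if s <= b then g s else h s.
pose chi s := if s <= b then phi s else psi s.
have ghl s : s <= b -> gh s = g s by rewrite /gh => ->.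
have ghr s : b <= s -> gh s = h s.
  rewrite le_eqVlt => /predU1P[<-|bs]; first by rewrite ghl// gb hb.
  by rewrite /gh leNgt bs.
have chil s : s <= b -> chi s = phi s by rewrite /chi => ->.
have chir s : b < s -> chi s = psi s by rewrite /chi ltNge => /negbTE ->.
(* The second interval is open at b, where [chi] follows [phi], so that the union is disjoint. *)
have split_itv : `[a, e]%classic = `[a, b]%classic `|` `]b, e]%classic.
  apply/seteqP; split => s /=; rewrite !in_itv/=.
    by move=> /andP[as_ se]; have [sb|bs] := leP s b; [left|right]; rewrite ?as_.
  by case=> /andP[h1 h2]; apply/andP; split; lra.
have mchi1 : measurable_fun `[a, b]%classic chi.
  apply: eq_measurable_fun mphi => s; rewrite inE/= in_itv/= => /andP[_ sb].
  by rewrite chil.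
have mpsi' : measurable_fun `]b, e]%classic psi.
  by apply: measurable_funS mpsi => //; apply: subset_itvr; rewrite bnd_simp.
have mchi2 : measurable_fun `]b, e]%classic chi.
  apply: eq_measurable_fun mpsi' => s; rewrite inE/= in_itv/= => /andP[bs _].
  by rewrite chir.
have dens s : a <= s <= e -> unit_ball (gh s) /\ hyp_density (gh s) <= chi s.
  move=> /andP[as_ se]; have [sb|bs] := leP s b.
    by rewrite ghl// chil//; split; [apply: gB | apply: gphi]; rewrite as_.
  by rewrite ghr ?chir ?(ltW bs)//; split; [apply: hB | apply: hpsi]; rewrite se ltW.
have chi0 s : a <= s <= e -> 0 <= chi s.
  by move=> /dens[B]; apply: le_trans; exact: hyp_density_ge0.
exists e, gh, chi; split.
- split; [exact: le_trans be|by rewrite ghl|by rewrite ghr|by move=> s /dens[]].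
- move=> s /andP[as_ se]; have [sb|bs] := leP s b.
    rewrite (@eq_length _ _ gh g) ?gl ?as_// => t /andP[_ ts].
    by rewrite ghl// (le_trans ts).
  rewrite (lengthD gh ab (ltW bs)) (@eq_length _ _ gh g) => [|t /andP[_]/ghl//].
  rewrite (@eq_length _ _ gh h) => [|t /andP[/ghr]//].
  rewrite gl ?ab ?lexx// hl ?(ltW bs)//= -EFinD; congr EFin; ring.
- by rewrite split_itv; apply/measurable_funU.
- by move=> s /dens[].
- rewrite split_itv ge0_integral_setU//=; last 3 first.
  + by apply/measurable_EFinP/measurable_funU.
  + move=> s sU; have : `[a, e]%classic s by rewrite split_itv.
    by rewrite /= in_itv/= lee_fin; exact: chi0.
  + apply/disj_setPLR => s /=; rewrite !in_itv/= => /andP[_ sb].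
    by apply/negP; rewrite negb_and -leNgt sb.
  rewrite EFinD; apply: leeD.
    apply: le_trans iphi; rewrite le_eqVlt; apply/orP; left; apply/eqP.
    by apply: eq_integral => s; rewrite inE/= in_itv/= => /andP[_ sb]; rewrite chil.
  apply: le_trans ipsi.
  have -> : (\int[lebesgue_measure]_(s in `]b, e]) (chi s)%:E =
      \int[lebesgue_measure]_(s in `]b, e]) (psi s)%:E)%E.
    by apply: eq_integral => s; rewrite inE/= in_itv/= => /andP[bs _]; rewrite chir.
  apply: ge0_subset_integral => //=.
  + exact/measurable_EFinP.
  + move=> s; rewrite in_itv/= => sbe; rewrite lee_fin; apply: le_trans (hpsi s sbe).
    by apply: hyp_density_ge0; exact: hB.
  + by apply: subset_itvr; rewrite bnd_simp.
Qed.

Lemma reachable_segment (R : realType) (n : nat) (p v : 'rV[R]_n) (l c : R)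
    (phi : R -> R) :
  0 <= l -> enorm v = 1 ->
  (forall s, 0 <= s <= l -> unit_ball (p + s *: v) /\ hyp_density (p + s *: v) <= phi s) ->
  (forall a, measurable_fun `[a, a + l]%classic (fun s => phi (s - a)) /\
   (\int[lebesgue_measure]_(s in `[a, (a + l)%R]) (phi (s - a))%:E <= c%:E)%E) ->
  reachable_at_cost p (p + l *: v) c.
Proof.
move=> l0 v1 dens int a; have [mphi iphi] := int a.
exists (a + l), (fun s => p + (s - a) *: v), (fun s => phi (s - a)).
have sl s : a <= s <= a + l -> 0 <= s - a <= l by move=> ?; apply/andP; split; lra.
split => //.
- split; first by rewrite lerDl.
  + by rewrite subrr scale0r addr0.
  + by rewrite addrAC subrr add0r.
  + by move=> s /sl /dens[].
- by move=> s /andP[as_ _]; exact: length_line.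
- by move=> s /sl /dens[].
Qed.

(** [hyp_dist] is [fine] of an infimum, so it obeys bounds once the infimum is finite: one curve of
    cost at most c bounds it above, and nonnegativity of the density bounds it below. *)
Lemma reachable_hyp_dist (R : realType) (n : nat) (x y : 'rV[R]_n) (c : R) :
  reachable_at_cost x y c ->
  hyp_dist x y <= c /\
  (forall V, (forall a b g, rectifiable_curve (@unit_ball R n) x y a b g ->
      (V%:E <= path_integral a b g (@hyp_density R n))%E) -> V <= hyp_dist x y).
Proof.
move=> /(_ 0)[b [g [phi [[b0 ga gb gB] gl mphi gphi iphi]]]].
have gl0 (s : R) : 0 <= s <= b -> curve_length 0 s g = s%:E by move=> /gl ->; rewrite subr0.
have lip (s t : R) : 0 <= s -> s <= t -> t <= b -> enorm (g t - g s) <= t - s.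
  move=> s0 st tb; have t0 : 0 <= t by lra.
  have [l1 [l2 []]] := length_split s0 st (gl0 t (introT andP (conj t0 tb))).
  rewrite gl0 ?s0 ?(le_trans st)// => -[sl1] h tl.
  by have := chord_le_length g st; rewrite h lee_fin; lra.
have rc : rectifiable_curve (@unit_ball R n) x y 0 b g.
  split => //; last by rewrite gl0 ?b0 ?lexx// ltry.
  apply/subspace_continuousP => t; rewrite /= in_itv/= => /andP[t0 tb].
  apply/cvgrPdist_lt => e e0; rewrite near_withinE; exists e => //= u ut.
  rewrite in_itv/= => /andP[u0 ub]; apply: le_lt_trans ut.
  have : enorm (g t - g u) <= `|t - u|.
    have [ut|tu] := leP u t; first by rewrite ger0_norm ?subr_ge0//; exact: lip.
    by rewrite enormB distrC ger0_norm ?subr_ge0 ?(ltW tu)//; exact: lip t0 (ltW tu) ub.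
  apply: le_trans; exact: norm_le_enorm.
have pathE : (path_integral 0 b g (@hyp_density R n) <= c%:E)%E.
  rewrite /path_integral gl0 ?b0 ?lexx//=; apply: le_trans iphi.
  apply: integral_le => s; rewrite /= in_itv/= => sb.
  (* A unit-speed curve started at time 0 is its own arc length parametrization. *)
  suff -> : arc_param 0 b g s = g s by rewrite gphi// hyp_density_ge0//; exact: gB.
  rewrite /arc_param; case: xgetP => [t _ [tb]|none]; last first.
    by case: (none s); split => //; exact: gl0.
  by rewrite gl0// => -[->].
rewrite /hyp_dist; set S := [set l | _].
have inS : S (path_integral 0 b g (@hyp_density R n)) by exists 0, b, g.
have inf_le : (ereal_inf S <= c%:E)%E by apply: le_trans pathE; exact: ereal_inf_lbound.
have geS V : (forall a b g, rectifiable_curve (@unit_ball R n) x y a b g ->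
    (V%:E <= path_integral a b g (@hyp_density R n))%E) -> (V%:E <= ereal_inf S)%E.
  by move=> h; apply: le_ereal_inf_tmp => _ [a' [b' [g' [rc' ->]]]]; exact: h.
have inf0 : (0%:E <= ereal_inf S)%E.
  apply: geS => a' b' g' rc'; apply: integral_ge0 => s /=; rewrite in_itv/= => sl.
  case: rc' => ab' cg' gB' _ fin'; rewrite lee_fin; apply: hyp_density_ge0.
  have len_fin : curve_length a' b' g' \is a fin_num.
    by rewrite ge0_fin_numE// length_ge0.
  have [[t tab ->] _ _] := arc_param_lipschitz ab' cg' (esym (fineK len_fin)) sl.
  exact: gB'.
have inf_fin : ereal_inf S \is a fin_num.
  by rewrite ge0_fin_numE//; apply: le_lt_trans inf_le _; rewrite ltry.
split; first by rewrite -lee_fin fineK.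
by move=> V /geS; rewrite -lee_fin fineK.
Qed.

(** * Radial and chordal pieces; distance to the boundary *)

(** The change of starting time is made in the primitive [Phi], so its increment, and hence the
    cost, does not depend on a. *)
Lemma reachable_segment_FTC (R : realType) (n : nat) (p v : 'rV[R]_n) (l : R)
    (phi Phi : R -> R) :
  0 <= l -> enorm v = 1 ->
  (forall s, 0 <= s <= l -> unit_ball (p + s *: v) /\ hyp_density (p + s *: v) <= phi s) ->
  (forall s, 0 <= s <= l -> is_derive s 1 Phi (phi s)) ->
  (forall s, 0 <= s <= l -> {for s, continuous phi}) ->
  reachable_at_cost p (p + l *: v) (Phi l - Phi 0).
Proof.
move=> l0 v1 dens dPhi cphi; apply: (reachable_segment l0 v1 dens) => a.
have al : a <= a + l by rewrite lerDl.
have sl s : a <= s <= a + l -> 0 <= s - a <= l by move=> ?; apply/andP; split; lra.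
have [||mphi iphi] := @integral_FTC R (fun s => phi (s - a)) (fun s => Phi (s - a)) _ _ al.
- move=> s /sl/dPhi d1.
  have d2 : is_derive s 1 (fun t : R => t - a) 1.
    by have := is_deriveB (is_derive_id s 1) (is_derive_cst a s 1); rewrite subr0.
  have := @is_derive1_comp _ Phi (fun t => t - a) s _ _ d1 d2.
  by rewrite mulr1.
- move=> s /sl/cphi cs; apply: (@continuous_comp _ _ _ (fun t => t - a) phi) => //.
  by apply: cvgB; [exact: cvg_id | exact: cvg_cst].
by split=> //; rewrite iphi [a + l]addrC addrK subrr.
Qed.

(* Hyperbolic distance from the centre to a point at Euclidean distance [t]. *)
Definition hyp_radius (R : realType) (t : R) : R := ln (1 + t) - ln (1 - t).

(** The sign [sg] covers outward and inward motion together. With r = t + sg s, the density is 1 /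
    (1 + r) + 1 / (1 - r), the derivative of [hyp_radius] at r. *)
Lemma reachable_radial (R : realType) (n : nat) (v : 'rV[R]_n) (t l sg : R) :
  enorm v = 1 -> sg ^+ 2 = 1 -> 0 <= l ->
  (forall s, 0 <= s <= l -> 0 <= t + sg * s < 1) ->
  reachable_at_cost (t *: v) ((t + sg * l) *: v)
    (sg * (hyp_radius (t + sg * l) - hyp_radius t)).
Proof.
move=> v1 sg1 l0 inside.
pose phi s := sg *: (sg / (1 + t + sg * s) - (- sg) / (1 - t + (- sg) * s)).
pose Phi s := sg *: (ln (1 + t + sg * s) - ln (1 - t + (- sg) * s)).
have pos s : 0 <= s <= l -> 0 < 1 + t + sg * s /\ 0 < 1 - t + (- sg) * s.
  by move=> /inside /andP[h1 h2]; split; lra.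
have -> : (t + sg * l) *: v = t *: v + l *: (sg *: v).
  by rewrite scalerA -scalerDl [sg * l]mulrC.
have -> : sg * (hyp_radius (t + sg * l) - hyp_radius t) = Phi l - Phi 0.
  rewrite /Phi -mulrBr /hyp_radius mulr0 addr0 mulr0 addr0.
  by congr (_ * (ln _ - ln _ - (ln _ - ln _))); ring.
apply: (@reachable_segment_FTC _ _ _ _ _ phi) => //.
- rewrite enormZ v1 mulr1 -(@ger0_norm _ 1)// -sg1.
  by apply/eqP; rewrite -(@eqrXn2 _ 2)// ?normr_ge0// real_normK ?num_real// sg1 normr1 expr1n.
- move=> s sl; have [p1 p2] := pos s sl; have /andP[i0 i1] := inside s sl.
  have zE : enorm (t *: v + s *: (sg *: v)) = t + sg * s.
    by rewrite scalerA -scalerDl enormZ v1 mulr1 [s * sg]mulrC ger0_norm.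
  rewrite /unit_ball/= /hyp_density zE; split => //.
  rewrite le_eqVlt; apply/orP; left; apply/eqP.
  have sgE x y : sg *: (sg / x - - sg / y) = sg ^+ 2 * (x^-1 + y^-1).
    by rewrite -[LHS]/(sg * _); ring.
  rewrite /phi sgE sg1 mul1r; field.
  by rewrite !gt_eqF//=; nra.
- move=> s /pos[p1 p2]; apply: is_deriveZ; apply: is_deriveB; exact: is_derive_ln_affine.
- move=> s /pos[p1 p2]; apply: cvgZl_tmp; apply: cvgB; exact: continuous_inv_affine.
Qed.

Lemma reachable_outward (R : realType) (n : nat) (v : 'rV[R]_n) (t u : R) :
  enorm v = 1 -> 0 <= t -> t <= u -> u < 1 ->
  reachable_at_cost (t *: v) (u *: v) (hyp_radius u - hyp_radius t).
Proof.
move=> v1 t0 tu u1; have := @reachable_radial _ _ v t (u - t) 1 v1.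
rewrite !mul1r subrKC; apply; rewrite ?expr1n ?subr_ge0// => s.
by rewrite mul1r; lra.
Qed.

Lemma reachable_inward (R : realType) (n : nat) (v : 'rV[R]_n) (t u : R) :
  enorm v = 1 -> 0 <= t -> t <= u -> u < 1 ->
  reachable_at_cost (u *: v) (t *: v) (hyp_radius u - hyp_radius t).
Proof.
move=> v1 t0 tu u1; have := @reachable_radial _ _ v u (u - t) (-1) v1.
rewrite !mulN1r opprB subrKC opprB; apply; rewrite ?sqrrN ?expr1n ?subr_ge0// => s.
by rewrite mulN1r; lra.
Qed.

(** The closed ball of radius k is convex, so along the segment the density is at most its value at
    radius k; the cost is length times this constant. *)
Lemma reachable_chord (R : realType) (n : nat) (p q : 'rV[R]_n) (k : R) :
  (0 < n)%N -> enorm p <= k -> enorm q <= k -> k < 1 ->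
  reachable_at_cost p q (enorm (q - p) * (2 / (1 - k ^+ 2))).
Proof.
move=> n0 pk qk k1; have [v [v1 qpE]] := unit_vector_exists n0 (q - p).
set l := enorm (q - p) in qpE *; set K := 2 / _.
have l0 : 0 <= l by exact: enorm_ge0.
have qE : q = p + l *: v by rewrite -qpE addrC subrK.
have inside s : 0 <= s <= l -> enorm (p + s *: v) <= k.
  move=> /andP[s0 sl]; have [l_eq0|l_neq0] := eqVneq l 0.
    have -> : s = 0 by lra.
    by rewrite scale0r addr0.
  have lpos : 0 < l by rewrite lt0r l_neq0.
  rewrite -(ler_pM2l lpos) -{1}(ger0_norm l0) -enormZ.
  (* Convex combination of p and q, multiplied by l to avoid division. *)
  have -> : l *: (p + s *: v) = (l - s) *: p + s *: q.
    by rewrite qE !scalerDr scalerBl !scalerA [s * l]mulrC addrA subrK.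
  apply: le_trans (ler_enormD _ _) _; rewrite !enormZ !ger0_norm ?subr_ge0//.
  by have := enorm_ge0 p; have := enorm_ge0 q; nra.
have := @reachable_segment_FTC _ _ p v l (fun=> K) (fun s => K *: s) l0 v1.
rewrite -qE scaler0 subr0 mulrC; apply.
- move=> s /inside zk; split; first by rewrite /unit_ball/=; lra.
  exact: hyp_density_le.
- by move=> s _; have := is_deriveZ K (is_derive_id s 1); rewrite [K *: 1]mulr1.
- by move=> s _; exact: cvg_cst.
Qed.

(** By continuity of the norm the ball is open and its closure lies in the closed ball; a point z of
    the sphere is the limit of the interior points (1 - e) z. *)
Lemma boundary_unit_ball (R : realType) (n : nat) :
  boundary (@unit_ball R n) = [set z | enorm z = 1].
Proof.
have ball_open : open (@unit_ball R n).
  by have /continuousP/(_ _ (@open_lt _ 1)) := @enorm_continuous R n.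
rewrite /boundary; move/interior_id : ball_open => ->.
apply/seteqP; split => z /=.
  move=> [zcl /negP]; rewrite /unit_ball/= -leNgt => z1; apply/eqP; rewrite eq_le z1 andbT.
  have ball_closed : closed [set z : 'rV[R]_n | enorm z <= 1].
    by have /continuous_closedP/(_ _ (@closed_le _ 1)) := @enorm_continuous R n.
  suff : [set z : 'rV[R]_n | enorm z <= 1] z by [].
  by rewrite ((closure_id _).1 ball_closed); apply: closureS zcl => u; exact: ltW.
move=> z1; split; last by rewrite /unit_ball/= z1 ltxx.
move=> B Bz; have : t *: z @[t --> (1 : R)] --> z.
  rewrite -{2}(scale1r z); apply: cvgZ; [exact: cvg_id | exact: cvg_cst].
move=> /(_ B Bz) [d /= d0 dB].
pose e := Num.min d 1 / 2.
have e0 : 0 < e by rewrite divr_gt0// lt_min d0 ltr01.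
have [ed e1] : e < d /\ e < 1.
  by rewrite /e; have [|] := leP d 1; split; lra.
exists ((1 - e) *: z); split.
  by rewrite /unit_ball/= enormZ z1 mulr1 ger0_norm; lra.
by apply: dB; rewrite /ball/= opprB addrCA subrr addr0 gtr0_norm.
Qed.

(** The triangle inequality bounds the infimum below, and the unit vector in the direction of x
    attains it. *)
Lemma bdist_unit_ball (R : realType) (n : nat) (x : 'rV[R]_n) :
  (0 < n)%N -> unit_ball x -> bdist (@unit_ball R n) x = 1 - enorm x.
Proof.
rewrite /unit_ball/= => n0 x1; rewrite /bdist boundary_unit_ball.
have [v [v1 xE]] := unit_vector_exists n0 x.
set S := [set enorm (x - z) | z in _].
have Sx : S (1 - enorm x).
  exists v => //; rewrite {1}xE -{2}(scale1r v) -scalerBl enormZ v1 mulr1 distrC.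
  by rewrite ger0_norm// subr_ge0 ltW.
have lbS : lbound S (1 - enorm x).
  move=> _ [z /= z1 <-]; have := ler_dist_enorm z x.
  by rewrite ler_norml z1 enormB => /andP[_].
apply/eqP; rewrite eq_le; apply/andP; split.
  by apply: ge_inf => //; exists (1 - enorm x).
by apply: lb_le_inf => //; exists (1 - enorm x).
Qed.

(** * Comparison of the two metrics *)

(** With w = 1 / (2 - h) the left side is 2 (1 - w), so this is ln w <= w - 1. *)
Lemma chord_cost_le_ln (R : realType) (h : R) : 0 < h -> h < 1 ->
  2 * (1 - h) / (2 - h) <= 2 * ln (2 - h).
Proof.
move=> h0 h1; have p : 0 < 2 - h by lra.
have ip : 0 < (2 - h)^-1 by rewrite invr_gt0.
have := @le_ln1Dx R ((2 - h)^-1 - 1); rewrite subrKC lnV ?posrE// => /(_ _).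
have -> : 2 * (1 - h) / (2 - h) = 2 * (1 - (2 - h)^-1).
  by field; rewrite gt_eqF.
by move=> h2; have : - ln (2 - h) <= (2 - h)^-1 - 1 by [apply: h2; lra|]; lra.
Qed.

Lemma hyp_dist_upper (R : realType) (n : nat) (x y : 'rV[R]_n) (m : R) :
  (0 < n)%N -> unit_ball x -> unit_ball y ->
  1 - enorm x <= m -> 1 - enorm y <= m -> m <= 1 ->
  exists2 c, reachable_at_cost x y c &
    c <= 2 * ln (enorm (x - y) + m) - ln (1 - enorm x) - ln (1 - enorm y) + 2 * ln 2.
Proof.
rewrite /unit_ball/= => n0 x1 y1 xm ym m1.
have [v [v1 xE]] := unit_vector_exists n0 x.
have [w [w1 yE]] := unit_vector_exists n0 y.
have := ler_enorm_trans 0 x y; rewrite subr0 sub0r enormN => rxy.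
set r := enorm (x - y) in rxy *.
have r0 : 0 <= r by exact: enorm_ge0.
set a := enorm x in x1 xm xE rxy *; set b := enorm y in y1 ym yE rxy *.
have a0 : 0 <= a by exact: enorm_ge0.
have b0 : 0 <= b by exact: enorm_ge0.
have ln1D (t : R) : 0 <= t -> t < 1 -> ln (1 + t) <= ln 2.
  by move=> t0 t1; rewrite ler_ln ?posrE; lra.
have lna := ln1D a a0 x1; have lnb := ln1D b b0 y1.
(* Through the centre, each radius costs at most ln 2 - ln (1 - t), with t = a or b, and ln (r + m)
   >= 0. *)
have [h1|h1] := leP 1 (r + m).
  exists ((hyp_radius a - hyp_radius 0) + (hyp_radius b - hyp_radius 0)).
    apply: (@reachable_trans _ _ _ 0).
      rewrite -(scale0r v) xE; exact: reachable_inward.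
    rewrite -(scale0r w) yE; exact: reachable_outward.
  by rewrite /hyp_radius addr0 subr0 ln1; have := ln_ge0 h1; lra.
set h := r + m in h1 *.
have m0 : 0 < m by lra.
have h0 : 0 < h by rewrite /h; lra.
have ha : 1 - h <= a by rewrite /h; lra.
have hb : 1 - h <= b by rewrite /h; lra.
have rad : hyp_radius (1 - h) = ln (2 - h) - ln h.
  by rewrite /hyp_radius; congr (ln _ - ln _); ring.
(* From a b |v - w|^2 <= r^2 with a, b >= 1 - m, and r = h - m <= h (1 - m) because h < 1. *)
have vw : enorm (w - v) <= h.
  have e0 := enorm_ge0 (w - v).
  have E : a * b * enorm (w - v) ^+ 2 <= r ^+ 2.
    by rewrite enormB /r xE yE; exact: enorm_directions.
  have rle : r <= h * (1 - m).
    by have : 0 <= m * (1 - h); [rewrite mulr_ge0//; lra | rewrite /h; lra].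
  have pab : (1 - m) ^+ 2 <= a * b by rewrite expr2; apply: ler_pM; lra.
  have r2 : r ^+ 2 <= h ^+ 2 * (1 - m) ^+ 2.
    by rewrite -exprMn ler_pXn2r ?nnegrE//; nra.
  have m2 : 0 < (1 - m) ^+ 2 by rewrite exprn_gt0//; rewrite /h in h1; lra.
  have : enorm (w - v) ^+ 2 * (1 - m) ^+ 2 <= h ^+ 2 * (1 - m) ^+ 2.
    by apply: le_trans r2; apply: le_trans E; rewrite mulrC ler_wpM2r// sqr_ge0.
  by rewrite ler_pM2r// ler_pXn2r// nnegrE ltW.
exists ((hyp_radius a - hyp_radius (1 - h)) +
  enorm ((1 - h) *: w - (1 - h) *: v) * (2 / (1 - (1 - h) ^+ 2)) +
  (hyp_radius b - hyp_radius (1 - h))).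
  apply: (@reachable_trans _ _ _ ((1 - h) *: w)).
    apply: (@reachable_trans _ _ _ ((1 - h) *: v)).
      by rewrite xE; apply: reachable_inward => //; lra.
    apply: reachable_chord => //; rewrite ?enormZ ?v1 ?w1 ?mulr1 ?ger0_norm; lra.
  by rewrite yE; apply: reachable_outward => //; lra.
(* The chord is at most (1 - h) h long, and 1 - (1 - h)^2 = h (2 - h). *)
have chord : enorm ((1 - h) *: w - (1 - h) *: v) * (2 / (1 - (1 - h) ^+ 2)) <=
    2 * (1 - h) / (2 - h).
  rewrite -scalerBr enormZ ger0_norm; last lra.
  have -> : 2 * (1 - h) / (2 - h) = (1 - h) * h * (2 / (1 - (1 - h) ^+ 2)).
    by field; rewrite !gt_eqF//; nra.
  rewrite ler_wpM2r//; first by rewrite divr_ge0//; nra.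
  by rewrite ler_wpM2l//; lra.
(* The radial pieces contribute - 2 ln (2 - h) + 2 ln h; the first term absorbs the chord, and ln (1
   + a), ln (1 + b) are at most ln 2. *)
have := chord_cost_le_ln h0 h1; rewrite rad /hyp_radius; lra.
Qed.

Unset Implicit Arguments.

Theorem theorem3p5 (R : realType) (n : nat) (hn : (2 <= n)%N)
    (x y : 'rV[R]_n) (hx : unit_ball x) (hy : unit_ball y) :
  hyp_dist x y - 2 * ln 2 <= u_metric (@unit_ball R n) x y /\
  u_metric (@unit_ball R n) x y <= 2 * hyp_dist x y + 2 * ln 2.
Proof.
have n0 : (0 < n)%N by exact: ltn_trans hn.
have dx : 0 < 1 - enorm x by rewrite subr_gt0.
have dy : 0 < 1 - enorm y by rewrite subr_gt0.
have x0 := enorm_ge0 x; have y0 := enorm_ge0 y.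
have r0 := enorm_ge0 (x - y).
rewrite /u_metric !bdist_unit_ball//; set m := Num.max _ _.
have xm : 1 - enorm x <= m by rewrite le_max lexx.
have ym : 1 - enorm y <= m by rewrite le_max lexx orbT.
have m1 : m <= 1 by rewrite ge_max; apply/andP; split; lra.
have m0 : 0 < m by exact: lt_le_trans xm.
have sq : 0 < Num.sqrt ((1 - enorm x) * (1 - enorm y)) by rewrite sqrtr_gt0 mulr_gt0.
have uE : 2 * ln ((enorm (x - y) + m) / Num.sqrt ((1 - enorm x) * (1 - enorm y))) =
    2 * ln (enorm (x - y) + m) - ln (1 - enorm x) - ln (1 - enorm y).
  rewrite ln_div ?posrE ?ltr_wpDl// mulrBr -[RHS]addrA -opprD; congr (_ - _).
  rewrite mulr_natl -lnXn// sqr_sqrtr ?mulr_ge0 ?ltW// lnM ?posrE//.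
have [c rc cle] := hyp_dist_upper n0 hx hy xm ym m1.
have [dc dV] := reachable_hyp_dist rc.
have V1 := dV _ (fun a b g rg => (path_integral_ge rg).1).
have V2 := dV _ (fun a b g rg => (path_integral_ge rg).2).
rewrite uE; split; first by lra.
rewrite ln_div ?posrE// in V1; last lra.
rewrite ln_div ?posrE// in V2; last lra.
have tri := ler_dist_enorm x y; rewrite ler_norml in tri.
have lnD (s t : R) : 0 < s -> 0 < t -> s <= 2 * t -> ln s <= ln 2 + ln t.
  by move=> s0 t0 st; rewrite -lnM ?posrE// ler_ln ?posrE// mulr_gt0.
(* The lower bound for rho is used at the point nearer the boundary. If d(x) <= d(y), then m = d(y)
   <= d(x) + |x - y|, so |x - y| + m <= 2 (d(x) + |x - y|), and - ln d(y) <= - ln d(x) gives u <= 2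
   ln 2 + 2 ln (1 + |x - y| / d(x)). *)
have [dxy|dyx] := leP (1 - enorm x) (1 - enorm y).
  have mE : m = 1 - enorm y by rewrite /m; exact: max_r.
  have := lnD (enorm (x - y) + m) (1 - enorm x + enorm (x - y)).
  have : ln (1 - enorm x) <= ln (1 - enorm y) by rewrite ler_ln.
  by rewrite mE => h1 h2; have {h2} := h2 _ _ _; lra.
have mE : m = 1 - enorm x by rewrite /m; apply: max_l; exact: ltW.
have := lnD (enorm (x - y) + m) (1 - enorm y + enorm (x - y)).
have : ln (1 - enorm y) <= ln (1 - enorm x) by rewrite ler_ln// ltW.
by rewrite mE => h1 h2; have {h2} := h2 _ _ _; lra.
Qed.
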